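(* Let $r\in\mathbb N$ and let $\mathcal C$ be a hereditary class of graphs such that every graph in $\mathcal C$ is an $r$-bounded perturbation of a circle graph. Then $\mathcal C$ has bounded twin-width if and only if $\mathcal C$ does not contain all permutation graphs.
   Context: An elementary perturbation of a simple graph $G$ chooses a subset $X\subseteq V(G)$ and complements the adjacency relation on all pairs of vertices of $X$; an $r$-bounded perturbation of $G$ is the result of a sequence of at most $r$ elementary perturbations. Circle graphs: intersection graphs of chords of a circle. Permutation graphs: for a permutation $\pi$ of a linearly ordered set $V$, the graph on $V$ where $u<v$ are adjacent iff $\pi(v)<\pi(u)$. Hereditary: closed under induced subgraphs. Twin-width: in a trigraph (graph with some edges red), contracting $x_1,x_2$ into $x_0$ gives $N(x_0)=(N(x_1)\cup N(x_2))\setminus\{x_1,x_2\}$ and red neighbourhood $((N_r(x_1)\cup N_r(x_2))\setminus\{x_1,x_2\})\cup(N(x_1)\triangle N(x_2))$; twin-width is the minimum over contraction sequences to one vertex of the maximum red degree; a class has bounded twin-width if a constant bounds it on all members. *)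

(* Defs.v *)
From mathcomp Require Import all_boot all_order all_fingroup all_algebra.
From mathcomp Require Import boolp classical_sets reals.

Set Implicit Arguments.
Unset Strict Implicit.
Unset Printing Implicit Defensive.

Import Order.TTheory GRing.Theory Num.Theory.

Record sgraph := SGraph {
  vertex :> finType;
  adj : rel vertex;
  adj_sym : symmetric adj;
  adj_irrefl : irreflexive adj }.

Definition graph_iso (G H : sgraph) : Prop :=
  exists2 f : G -> H, bijective f & forall u v, adj (f u) (f v) = adj u v.

Section Induced.
Variables (G : sgraph) (S : {set G}).

Definition induced_adj : rel {x : G | x \in S} := fun u v => adj (val u) (val v).

Lemma induced_sym : symmetric induced_adj.
Proof. by move=> u v; rewrite /induced_adj adj_sym. Qed.

Lemma induced_irrefl : irreflexive induced_adj.
Proof. by move=> u; rewrite /induced_adj adj_irrefl. Qed.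

Definition induced : sgraph := SGraph induced_sym induced_irrefl.
End Induced.

Definition graph_class := sgraph -> Prop.

(* Graph classes are understood up to isomorphism, hence the first clause. *)
Definition hereditary (C : graph_class) : Prop :=
  (forall G H, graph_iso G H -> C G -> C H) /\
  (forall (G : sgraph) (S : {set G}), C G -> C (induced S)).

Section Perturbation.
Variables (G : sgraph) (X : {set G}).

Definition perturb_adj : rel G :=
  fun u v => adj u v (+) [&& u != v, u \in X & v \in X].

Lemma perturb_sym : symmetric perturb_adj.
Proof.
by move=> u v; rewrite /perturb_adj adj_sym eq_sym [(u \in X) && _]andbC.
Qed.

Lemma perturb_irrefl : irreflexive perturb_adj.
Proof. by move=> u; rewrite /perturb_adj adj_irrefl eqxx. Qed.

Definition perturb : sgraph := SGraph perturb_sym perturb_irrefl.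
End Perturbation.

(* The vertex type of [perturb X] is convertible to that of [G], so the
   successive sets can all be taken over the vertices of [G]. *)
Fixpoint perturbs (G : sgraph) (Xs : seq {set G}) : sgraph :=
  if Xs is X :: Ys then @perturbs (perturb X) Ys else G.

Definition bounded_perturbation (r : nat) (G H : sgraph) : Prop :=
  exists2 Xs : seq {set G}, (size Xs <= r)%N & graph_iso (perturbs Xs) H.

Section Circle.
Local Open Scope ring_scope.
Local Open Scope classical_set_scope.
Variable R : realType.

Definition unit_circle : set (R * R) := [set p | p.1 ^+ 2 + p.2 ^+ 2 = 1].

Definition segment (a b : R * R) : set (R * R) :=
  [set p | exists2 t : R, 0 <= t <= 1 &
     p = ((1 - t) * a.1 + t * b.1, (1 - t) * a.2 + t * b.2)].

Definition chord (A : set (R * R)) : Prop :=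
  exists a b, [/\ unit_circle a, unit_circle b, a <> b & A = segment a b].

Definition circle_graph (G : sgraph) : Prop :=
  exists2 c : G -> set (R * R), forall v, chord (c v) &
    forall u v, u != v -> (adj u v <-> c u `&` c v !=set0).
End Circle.

Section PermutationGraph.
Local Open Scope order_scope.
Variables (d : Order.disp_t) (V : finOrderType d) (s : {perm V}).

Definition permutation_adj : rel V :=
  fun u v => (u < v) && (s v < s u) || (v < u) && (s u < s v).

Lemma permutation_sym : symmetric permutation_adj.
Proof. by move=> u v; rewrite /permutation_adj orbC. Qed.

Lemma permutation_irrefl : irreflexive permutation_adj.
Proof. by move=> u; rewrite /permutation_adj ltxx. Qed.

Definition permutation_graph : sgraph :=
  SGraph permutation_sym permutation_irrefl.
End PermutationGraph.

Definition contains_all_permutation_graphs (C : graph_class) : Prop :=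
  forall (d : Order.disp_t) (V : finOrderType d) (s : {perm V}),
    C (permutation_graph s).

(* [tadj] is the adjacency of the underlying graph: all edges, red or not. *)
Record trigraph := Trigraph {
  tvertex :> finType;
  tadj : rel tvertex;
  tred : rel tvertex;
  tadj_sym : symmetric tadj;
  tadj_irrefl : irreflexive tadj;
  tred_sym : symmetric tred;
  tred_adj : subrel tred tadj }.

Definition trigraph_of (G : sgraph) : trigraph :=
  @Trigraph G (@adj G) (fun _ _ => false) (@adj_sym G) (@adj_irrefl G)
    (fun _ _ => erefl) (fun _ _ (h : false) => False_ind _ (notF h)).

Section Contraction.
Variables (T : trigraph) (x1 x2 : T).

(* [None] is the new vertex x0; [x1] and [x2] are no longer vertices, which
   accounts for the set difference in the neighbourhoods of x0. *)
Definition contract_vertex : finType :=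
  option {x : T | x \notin [set x1; x2]}.

Definition contract_adj : rel contract_vertex := fun u v =>
  match u, v with
  | Some u, Some v => tadj (val u) (val v)
  | Some u, None | None, Some u => tadj x1 (val u) || tadj x2 (val u)
  | None, None => false
  end.

Definition contract_red : rel contract_vertex := fun u v =>
  match u, v with
  | Some u, Some v => tred (val u) (val v)
  | Some u, None | None, Some u =>
      [|| tred x1 (val u), tred x2 (val u)
        | tadj x1 (val u) (+) tadj x2 (val u)]
  | None, None => false
  end.

Lemma contract_adj_sym : symmetric contract_adj.
Proof. by move=> [u|] [v|] //=; rewrite tadj_sym. Qed.

Lemma contract_adj_irrefl : irreflexive contract_adj.
Proof. by move=> [u|] //=; rewrite tadj_irrefl. Qed.

Lemma contract_red_sym : symmetric contract_red.
Proof. by move=> [u|] [v|] //=; rewrite tred_sym. Qed.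

Lemma contract_red_adj : subrel contract_red contract_adj.
Proof.
have h (w : T) : [|| tred x1 w, tred x2 w | tadj x1 w (+) tadj x2 w] ->
    tadj x1 w || tadj x2 w.
  case/or3P => [/tred_adj->|/tred_adj->|] //; first by rewrite orbT.
  by case: (tadj x1 w).
by move=> [u|] [v|] //=; [exact: tred_adj | exact: h | exact: h].
Qed.

Definition contract : trigraph :=
  Trigraph contract_adj_sym contract_adj_irrefl contract_red_sym
    contract_red_adj.

Lemma card_contract : x1 != x2 -> #|T| = #|contract|.+1.
Proof.
move=> x12; rewrite card_option card_sig.
rewrite -(cardC (mem [set x1; x2])) cards2 x12.
by rewrite !addSn add0n; congr (_.+2); apply: eq_card => x; rewrite !inE.
Qed.
End Contraction.

Definition red_degree (T : trigraph) (x : T) : nat := #|[set y | tred x y]|.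
Definition max_red_degree (T : trigraph) : nat := \max_(x : T) red_degree x.

(* The sequence ends at a one-vertex trigraph; the bound [<= 1] only adds the
   empty graph, which thereby gets twin-width 0. *)
Inductive contraction_sequence (T : trigraph) : Type :=
| ContractionEnd of (#|T| <= 1)%N
| ContractionStep (x1 x2 : T) of x1 != x2 &
    contraction_sequence (contract x1 x2).

Fixpoint width (T : trigraph) (s : contraction_sequence T) : nat :=
  match s with
  | ContractionEnd _ => max_red_degree T
  | ContractionStep x1 x2 _ s' => maxn (max_red_degree T) (width s')
  end.

Lemma contraction_sequence_exists (T : trigraph) :
  exists w, `[< exists s : contraction_sequence T, width s = w >].
Proof.
suff [s] : inhabited (contraction_sequence T).
  by exists (width s); apply/asboolP; exists s.
have [n] := ubnP #|T|; elim: n T => // n IH T ltTn.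
have [le1|/card_gt1P[x [y [_ _ xy]]]] := leqP #|T| 1.
  by constructor; apply: ContractionEnd.
have [|s] := IH (contract x y); first by rewrite -ltnS -card_contract.
by constructor; apply: ContractionStep xy s.
Qed.

Definition twin_width (G : sgraph) : nat :=
  ex_minn (contraction_sequence_exists (trigraph_of G)).

Definition bounded_twin_width (C : graph_class) : Prop :=
  exists c : nat, forall G, C G -> (twin_width G <= c)%N.

(* Main.v *)
(* If C omits the permutation graph of s, the chord diagram of any G in C, seen
   as points (left end, right end) in the plane, has no large grid division:
   colour the points by their membership in the perturbed sets; on one colour
   class the perturbation is the identity or complementation, and a large enough
   grid contains, for some colour, the pattern of s or its reverse in that
   colour, whichever of the two that class turns into the permutation graph.
   By the Marcus-Tardos theorem the number of nonempty cells of an interval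
   partition of the circle into m intervals is then linear in m, so that two
   consecutive intervals meeting boundedly many cells can always be merged
   (Guillemot-Marx).  The vertices lying in one cell with one colour form the
   parts of a contraction sequence: two parts are homogeneous unless their cells
   share an interval.
   Conversely, in the permutation graph of (a, b) |-> (-b, a) on a k x k grid
   ordered lexicographically, any two vertices are separated by at least k - 2
   others, so that the first contraction already has large red degree. *)
Require Import Defs.
From mathcomp Require Import all_boot all_order all_algebra.
From mathcomp Require Import boolp classical_sets reals.
From mathcomp Require Import fintype finset perm zify ring lra.

Set Implicit Arguments.
Unset Strict Implicit.
Unset Printing Implicit Defensive.

Import Order.TTheory GRing.Theory Num.Theory.

Lemma twin_width_leP (G : sgraph) (c : nat) :
  (twin_width G <= c)%N <->
  exists s : contraction_sequence (trigraph_of G), (width s <= c)%N.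
Proof.
rewrite /twin_width; case: ex_minnP => w /asboolP[s <-] minw; split.
  by move=> ?; exists s.
by case=> s' s'c; apply: leq_trans s'c; apply: minw; apply/asboolP; exists s'.
Qed.

(** * Trigraphs as quotients of a graph by a partition *)

Section Quotient.
Variable G : sgraph.

Definition linked (F : Type) (f : G -> F) (x y : F) : Prop :=
  exists u v, [/\ f u = x, f v = y & adj u v].

Definition mixed (F : Type) (f : G -> F) (x y : F) : Prop :=
  linked f x y /\ exists u v, [/\ f u = x, f v = y & ~~ adj u v].

Lemma mixed_sym F (f : G -> F) x y : mixed f x y -> mixed f y x.
Proof.
case=> [[u [v [fu fv uv]]] [u' [v' [fu' fv' uv']]]].
by split; [exists v, u|exists v', u']; rewrite adj_sym.
Qed.

(** The conditions determine [T] from the partition of [G] into the fibres of [p], so the order of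
    earlier contractions can be forgotten. *)
Definition quotient (T : trigraph) (p : G -> T) : Prop :=
  [/\ forall x, exists u, p u = x,
      forall x y, x != y -> tadj x y <-> linked p x y &
      forall x y, x != y -> tred x y <-> mixed p x y].

Lemma quotient_id : @quotient (trigraph_of G) id.
Proof.
split=> [x|x y xy|x y xy] /=; first by exists x.
  by split=> [h|[u [v [<- <-]]]//]; exists x, y.
by split=> // -[[u [v [-> -> uv]]]] [u' [v' [-> -> ]]]; rewrite uv.
Qed.

Lemma quotient_contract (T : trigraph) (p : G -> T) (x1 x2 : T) :
  x1 != x2 -> quotient p ->
  @quotient (contract x1 x2) (fun u => insub (p u)).
Proof.
move=> x12 [surj adjP redP].
pose q u : contract x1 x2 := insub (p u).
have qS u (z : {x : T | x \notin [set x1; x2]}) : q u = Some z <-> p u = val z.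
  rewrite /q; split=> [|->]; last by rewrite valK.
  by case: insubP => // w _ <- [->].
have qN u : q u = None <-> (p u = x1 \/ p u = x2).
  rewrite /q; case: insubP => [w|]; last first.
    by rewrite negbK !inE => /orP[]/eqP->; split; auto.
  by rewrite !inE negb_or => /andP[/eqP n1 /eqP n2] _; split=> // -[].
have qsurj x : exists u, q u = x.
  case: x => [z|]; first by have [u pu] := surj (val z); exists u; apply/qS.
  by have [u pu] := surj x1; exists u; apply/qN; left.
have nin (z : {x : T | x \notin [set x1; x2]}) : x1 != val z /\ x2 != val z.
  have := valP z; rewrite !inE negb_or => /andP[].
  by rewrite ![val z == _]eq_sym.
have linkS z w : linked q (Some z) (Some w) <-> linked p (val z) (val w).
  by split=> -[u [v [/qS ? /qS ? ?]]]; exists u, v; split=> //; apply/qS.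
have linkN z : linked q None (Some z) <->
    (linked p x1 (val z) \/ linked p x2 (val z)).
  split=> [[u [v [/qN[] pu /qS pv uv]]]|[]].
  - by left; exists u, v.
  - by right; exists u, v.
  - by case=> u [v [pu pv uv]]; exists u, v; split=> //; [apply/qN; left|apply/qS].
  - by case=> u [v [pu pv uv]]; exists u, v; split=> //; [apply/qN; right|apply/qS].
have link_sym x y : linked q x y -> linked q y x.
  by case=> u [v [? ? ?]]; exists v, u; rewrite adj_sym.
have mixN z : mixed q None (Some z) <->
  [|| tred x1 (val z), tred x2 (val z) | tadj x1 (val z) (+) tadj x2 (val z)].
  have [n1 n2] := nin z.
  split.
    case=> /linkN h [u [v [/qN pu /qS pv uv]]].
    have [a1|/negP a1] := boolP (tadj x1 (val z)); last first.
      have [a2|/negP a2] := boolP (tadj x2 (val z)); first by rewrite !orbT.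
      by case: h => h; [case: a1|case: a2]; apply/adjP.
    have [a2|/negP a2] := boolP (tadj x2 (val z)); last by rewrite !orbT.
    case: pu => pu.
      have /redP-> // : mixed p x1 (val z).
      by split; [apply/adjP|exists u, v].
    have /redP-> // : mixed p x2 (val z); last by rewrite orbT.
    by split; [apply/adjP|exists u, v].
  case/or3P.
  - move/redP => /(_ n1)[h [u [v [pu /qS pv uv]]]]; split.
      by apply/linkN; left.
    by exists u, v; split=> //; apply/qN; left.
  - move/redP => /(_ n2)[h [u [v [pu /qS pv uv]]]]; split.
      by apply/linkN; right.
    by exists u, v; split=> //; apply/qN; right.
  (* Exactly one of the two old parts is linked to [z]: it supplies the edge, and the other, being
     nonempty, the non-edge. *)
  - have [v pv] := surj (val z).
    have [a1|/negP a1] := boolP (tadj x1 (val z)) => /=.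
      move=> a2; split; first by apply/linkN; left; apply/adjP.
      have [u pu] := surj x2; exists u, v; split; [by apply/qN; right|exact/qS|].
      by apply: contra a2 => uv; apply/adjP => //; exists u, v.
    move=> a2; split; first by apply/linkN; right; apply/adjP.
    have [u pu] := surj x1; exists u, v; split; [by apply/qN; left|exact/qS|].
    by apply/negP => uv; apply: a1; apply/adjP => //; exists u, v.
split=> //.
- case=> [z|] [w|] //= xy.
  + by rewrite linkS; apply: adjP.
  + split=> [h|/link_sym/linkN h].
      apply/link_sym/linkN.
      have [? ?] := nin z.
      by case/orP: h => h; [left|right]; apply/adjP.
    have [? ?] := nin z; case: h => /adjP-> //; exact: orbT.
  + split=> [h|/linkN h].
      apply/linkN.
      have [? ?] := nin w.
      by case/orP: h => h; [left|right]; apply/adjP.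
    have [? ?] := nin w; case: h => /adjP-> //; exact: orbT.
- case=> [z|] [w|] //= xy.
  + have zw : val z != val w by [].
    rewrite (redP _ _ zw).
    split=> -[/linkS h [u [v [pu pv uv]]]]; split=> //; exists u, v.
      by split=> //; apply/qS.
    by split=> //; apply/qS.
  + split=> [h|h]; [apply: mixed_sym; exact: (mixN z).2|exact: (mixN z).1 (mixed_sym h)].
  + by split; [exact: (mixN w).2|exact: (mixN w).1].
Qed.

(** * Contraction sequences along chains of partitions *)

Section Chain.
Variables (F : finType) (d k : nat).

Definition red_bounded (f : G -> F) : Prop :=
  forall x, (#|[set y | (y != x) && `[< mixed f x y >]]| <= d)%N.

Definition refines (F1 F2 : finType) (f : G -> F1) (g : G -> F2) : Prop :=
  (forall u v, f u = f v -> g u = g v) /\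
  forall x, (#|f @: [set u | g u == x]| <= k)%N.

(** A red neighbour of a part lies in the same class of [f] or in one of the at most [d] classes
    mixed with it, and each class contains at most [k] parts. *)
Lemma refines_red (T : trigraph) (p : G -> T) (f : G -> F) :
  quotient p -> refines p f -> red_bounded f ->
  (max_red_degree T <= k * d.+1)%N.
Proof.
case=> surj adjP redP [pf kf] rf; apply/bigmax_leqP => x _.
have [u pu] := surj x; rewrite /red_degree.
pose Y := f u |: [set y | (y != f u) && `[< mixed f (f u) y >]].
apply: (@leq_trans #|\bigcup_(y in Y) p @: [set v | f v == y]|).
  apply: subset_leq_card; apply/fintype.subsetP => z; rewrite inE => xz.
  have xnz : x != z.
    by apply: contraTneq xz => ->; apply/negP => /tred_adj; rewrite tadj_irrefl.
  have [v pv] := surj z.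
  apply/bigcupP; exists (f v); last first.
    by apply/imsetP; exists v; rewrite ?inE.
  rewrite !inE; case: eqP => //= _; apply/asboolP.
  move: xz => /redP - /(_ xnz) [[u1 [v1 [pu1 pv1 h1]]] [u2 [v2 [pu2 pv2 h2]]]].
  split; [exists u1, v1|exists u2, v2]; split=> //; apply: pf;
   by rewrite ?pu ?pv ?pu1 ?pu2 ?pv1 ?pv2.
apply: (@leq_trans (\sum_(y in Y) #|p @: [set v | f v == y]|)).
  elim/big_ind2: _ => [|A m B n Am Bn|y _]; rewrite ?cards0 //.
  by apply: leq_trans (leq_add Am Bn); rewrite cardsU leq_subr.
apply: (@leq_trans (\sum_(y in Y) k)); first by apply: leq_sum.
rewrite sum_nat_const mulnC leq_mul2l; apply/orP; right.
by rewrite cardsU1 -add1n; apply: leq_add; [apply: leq_b1|apply: rf].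
Qed.

(** Admitting every quotient that refines [f], and not only the fibres of [f], lets the sequences of
    successive partitions be concatenated. *)
Definition realizable (f : G -> F) : Prop :=
  red_bounded f /\ forall (T : trigraph) (p : G -> T), quotient p ->
    refines p f -> exists s : contraction_sequence T, (width s <= k * d.+1)%N.

(** While two parts lie in one class of [f], contract them: the result still refines [f], so
    [refines_red] bounds its red degree. Only the quotient by [f] itself remains. *)
Lemma realizable_aux (f : G -> F) : red_bounded f ->
  (forall (T : trigraph) (p : G -> T), quotient p ->
    (forall u v, p u = p v <-> f u = f v) ->
    (max_red_degree T <= k * d.+1)%N ->
    exists s : contraction_sequence T, (width s <= k * d.+1)%N) ->
  realizable f.
Proof.
move=> rf h; split=> // T.
have [n] := ubnP #|T|; elim: n T => // n IH T ltTn p qp pf.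
have rT := refines_red qp pf rf.
have [same|] := pselect (forall u v, f u = f v -> p u = p v).
  by apply: (h T p) => // u v; split; [apply: pf.1|apply: same].
move=> /existsNP[u /existsNP[v /not_implyP[fuv /eqP puv]]].
have := IH (contract (p u) (p v)) _ _ (quotient_contract puv qp).
case.
- by rewrite -ltnS -card_contract.
- set q := (X in refines X f).
  have qE x y : q x = q y ->
      p x = p y \/ p x \in [set p u; p v] /\ p y \in [set p u; p v].
    rewrite /q; case: insubP => [a _ <-|]; case: insubP => [b _ <-|] //.
      by case=> ->; left.
    by rewrite !negbK; right.
  split=> [x y /qE[/pf.1 //|]|x].
    by have e := fuv; rewrite !inE => -[] /orP[]/eqP/pf.1-> /orP[]/eqP/pf.1->.
  apply: leq_trans (pf.2 x).
  have -> : q @: [set w | f w == x] = insub @: (p @: [set w | f w == x]).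
    by rewrite -imset_comp.
  exact: leq_imset_card.
- by move=> s sw; exists (ContractionStep puv s) => /=; rewrite geq_max rT.
Qed.

Lemma realizable_const (f : G -> F) : red_bounded f ->
  (forall u v, f u = f v) -> realizable f.
Proof.
move=> rf cf; apply: realizable_aux => // T p [surj _ _] pf rT.
have T1 : (#|T| <= 1)%N.
  apply/card_le1_eqP => x y _ _; have [u <-] := surj x; have [v <-] := surj y.
  exact/pf.
by exists (ContractionEnd T1).
Qed.

Lemma realizable_step (f g : G -> F) : red_bounded f ->
  refines f g -> realizable g -> realizable f.
Proof.
move=> rf [fg kg] [rg h]; apply: realizable_aux => // T p qp pf _.
apply: h qp _; split=> [u v /pf/fg //|x].
apply: leq_trans (kg x).
(* As [p] and [f] have the same fibres, [phi] sends each value of [f] to its part, which bounds the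
   number of parts in a class of [g]. *)
pose phi y := omap p [pick u | f u == y].
have phiE u : phi (f u) = Some (p u).
  rewrite /phi; case: pickP => [v /eqP/pf/= -> //|/(_ u)].
  by rewrite eqxx.
pose A := [set u | g u == x].
have pE : Some @: (p @: A) = phi @: (f @: A).
  by rewrite -!imset_comp; apply: eq_imset => u /=; rewrite phiE.
have <- : #|Some @: (p @: A)| = #|p @: A| by rewrite card_imset // => ? ? [].
by rewrite pE leq_imset_card.
Qed.

End Chain.
End Quotient.

(** * Grids in planar point sets and the Marcus-Tardos theorem *)

(** The fibres of the monotone maps [a] and [b] are the intervals of a division of the two axes, so
    that no cut points have to be named. *)
Definition has_grid (t : nat) (P : nat -> nat -> Prop) : Prop :=
  exists a b : nat -> nat,
    [/\ {homo a : x y / (x <= y)%N}, {homo b : x y / (x <= y)%N} &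
        forall i j, (i < t)%N -> (j < t)%N ->
          exists x y, [/\ P x y, a x = i & b y = j]].

Lemma has_grid_map (c : nat -> nat) t (P Q : nat -> nat -> Prop) :
  {homo c : x y / (x <= y)%N} ->
  (forall x y, P x y -> exists x' y', [/\ Q x' y', c x' = x & c y' = y]) ->
  has_grid t P -> has_grid t Q.
Proof.
move=> hc PQ [a [b [ha hb h]]]; exists (a \o c), (b \o c); split.
- by move=> x y xy; apply/ha/hc.
- by move=> x y xy; apply/hb/hc.
- move=> i j it jt; have [x [y [/PQ[x' [y' [q cx cy]]] ai bj]]] := h i j it jt.
  by exists x', y'; split; rewrite //= ?cx ?cy.
Qed.

Lemma has_grid_swap t (P : nat -> nat -> Prop) :
  has_grid t P -> has_grid t (fun x y => P y x).
Proof.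
move=> [a [b [ha hb h]]]; exists b, a; split=> // i j it jt.
by have [x [y [? ? ?]]] := h j i jt it; exists y, x.
Qed.

Lemma leq_card_fibers (T U : finType) (f : T -> U) (A : {set T}) (B : {set U}) m :
  (forall x, x \in A -> f x \in B) ->
  (forall y, y \in B -> (#|[set x in A | f x == y]| <= m)%N) ->
  (#|A| <= #|B| * m)%N.
Proof.
move=> AB fib; rewrite -sum1_card (partition_big f (mem B)) //=.
rewrite -sum_nat_const; apply: leq_sum => y /fib; rewrite -sum1_card.
by under eq_bigl => x do rewrite inE.
Qed.

Lemma rank_surj N (A : {set 'I_N}) k : (k < #|A|)%N ->
  exists2 x : 'I_N, x \in A & #|[set y in A | (y < x)%N]| = k.
Proof.
move En: #|A| => n; elim: n A En k => [|n IH] A An k // kn.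
have [x0 x0A] : exists x, x \in A by apply/card_gt0P; rewrite An.
case: (@arg_maxnP _ x0 (mem A) (fun x : 'I_N => nat_of_ord x) x0A) => x xA xmax.
have Ax : #|A :\ x| = n by move: An; rewrite (cardsD1 x) (xA : x \in A) => -[].
have [kn'|] := ltnP k n.
  have [y yA <-] := IH _ Ax k kn'.
  exists y; first by move: yA; rewrite inE => /andP[].
  apply: eq_card => z; rewrite !inE; case: eqP => //= ->.
  apply/negP => /andP[_ xy]; move: yA; rewrite !inE => /andP[_ /xmax].
  by rewrite /= leqNgt xy.
move=> nk; have -> : k = n by apply/eqP; rewrite eqn_leq nk -ltnS kn.
exists x => //; rewrite -Ax; apply: eq_card => z; rewrite !inE andbC.
have [zA|] := boolP (z \in A); last by rewrite !andbF.
rewrite !andbT ltn_neqAle; have -> : (z <= x)%N by apply: xmax.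
by rewrite andbT.
Qed.

Section Blocks.
Variables (N s : nat).
Hypothesis s_gt0 : (0 < s)%N.

Lemma block_subproof (i : 'I_N) : (i %/ s < N)%N.
Proof. exact: leq_ltn_trans (leq_div _ _) (ltn_ord i). Qed.

(** Block indices stay in ['I_N], so that the nonempty blocks of a point set form a point set of the
    same type, to which an induction applies. *)
Definition block (i : 'I_N) : 'I_N := Ordinal (block_subproof i).

Lemma card_block J : (#|[set j | block j == J]| <= s)%N.
Proof.
pose f (j : 'I_N) : 'I_s := Ordinal (ltn_pmod j s_gt0).
rewrite -[X in (_ <= X)%N]card_ord -(card_in_imset (f := f)) ?max_card //.
move=> i j; rewrite !inE => /eqP iJ /eqP jJ [ij]; apply/val_inj => /=.
have : (i %/ s = j %/ s)%N by rewrite -[LHS]/(val (block i)) iJ -jJ.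
by move=> h; rewrite (divn_eq i s) (divn_eq j s) h ij.
Qed.

Section Wide.
Variables (T : finType) (S : {set T}) (x y : T -> 'I_N) (t : nat).

Definition block_cols (I J : 'I_N) : {set 'I_N} :=
  y @: [set p in S | (block (x p) == I) && (block (y p) == J)].

Lemma card_block_cols I J : (#|block_cols I J| <= s)%N.
Proof.
apply: leq_trans (card_block J); apply: subset_leq_card.
by apply/fintype.subsetP => j /imsetP[p]; rewrite !inE => /and3P[_ _ h] ->.
Qed.

(* Among many wide blocks of one block column, t have the same set of nonempty
   columns, and these blocks form a grid with t of those columns. *)
Lemma wide_blocks J : (0 < t)%N ->
  ~ has_grid t (fun i j => exists2 p, p \in S & (x p = i :> nat) /\ (y p = j :> nat)) ->
  (#|[set I | (t <= #|block_cols I J|)%N]| <= 2 ^ s * t)%N.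
Proof.
move=> t_gt0 nogrid; set W := finset _.
pose Q := [set K : {set 'I_N} | K \subset [set j | block j == J]].
have cQ : (#|Q| <= 2 ^ s)%N.
  by rewrite -/(powerset _) card_powerset leq_pexp2l ?card_block.
apply: (@leq_trans (#|Q| * t)); last by rewrite leq_mul2r cQ orbT.
apply: (@leq_card_fibers _ _ (block_cols^~ J)) => [I _|K _].
  rewrite inE; apply/fintype.subsetP => j /imsetP[p].
  by rewrite !inE => /and3P[_ _ h] ->.
rewrite leqNgt; apply/negP => tW; apply: nogrid.
set WK := finset _ in tW.
have [I0 I0K] : exists I, I \in WK.
  by apply/card_gt0P; apply: leq_ltn_trans tW.
have tK : (t <= #|K|)%N by move: I0K; rewrite !inE => /andP[h /eqP <-].
(* A row goes to the number of chosen blocks before its own, a column to its rank in [K]. *)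
exists (fun i => #|[set I in WK | (I < i %/ s)%N]|), (fun j => #|[set j' in K | (j' < j)%N]|).
split.
- move=> i i' ii'; apply: subset_leq_card; apply/fintype.subsetP => I.
  rewrite !inE => /andP[-> h] /=; exact: leq_trans h (leq_div2r _ ii').
- move=> i i' ii'; apply: subset_leq_card; apply/fintype.subsetP => I.
  rewrite !inE => /andP[-> h] /=; exact: leq_trans h ii'.
move=> i j it jt.
have [I IW Ii] := rank_surj (leq_trans it (ltnW tW)).
have [j' jK jj] := rank_surj (leq_trans jt tK).
have : j' \in block_cols I J by move: IW; rewrite !inE => /andP[_ /eqP->].
case/imsetP => p; rewrite !inE => /and3P[pS /eqP pI _] j'p.
exists (x p), (y p); split; first by exists p.
  by rewrite -Ii; apply: eq_card => z; rewrite !inE -pI.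
by rewrite -jj; apply: eq_card => z; rewrite !inE -j'p.
Qed.
End Wide.

End Blocks.

Lemma card_ord_ltn N n : (#|[set i : 'I_N | (i < n)%N]| <= n)%N.
Proof.
case: n => [|n]; first by rewrite (eq_card0 (A := finset _)) // => i; rewrite !inE.
pose f (i : 'I_N) : 'I_n.+1 := inord i.
rewrite -[X in (_ <= X)%N]card_ord -(card_in_imset (f := f)) ?max_card //.
move=> i j; rewrite !inE => iJ jJ /(congr1 val) /=; rewrite !inordK // => ij.
exact/val_inj.
Qed.

Definition cells N (S : {set 'I_N * 'I_N}) (i j : nat) : Prop :=
  exists2 p, p \in S & (p.1 = i :> nat) /\ (p.2 = j :> nat).

(** With blocks of side [s = 4 * t ^ 2], the blocks that are neither wide nor tall use at most half
    of the bound; the first summand pays for the others, and [+ s] for the case [n < s]. *)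
Definition marcus_tardos_constant (t : nat) : nat :=
  let s := 4 * t ^ 2 in 4 * s ^ 2 * (2 ^ s * t) + s.

(** Strong induction on [n], replacing blocks of side [s] by single points. By [wide_blocks] few
    blocks meet [t] columns or [t] rows; each other block has at most [t ^ 2] points. *)
Lemma marcus_tardos t N n (S : {set 'I_N * 'I_N}) : (0 < t)%N ->
  (forall p, p \in S -> (p.1 < n)%N && (p.2 < n)%N) ->
  ~ has_grid t (cells S) ->
  (#|S| <= marcus_tardos_constant t * n)%N.
Proof.
move=> t_gt0; rewrite /marcus_tardos_constant; set s := (4 * t ^ 2)%N.
set c := (X in (X * n)%N); set D := (2 ^ s * t)%N in c *.
have s_ge4 : (4 <= s)%N by rewrite /s leq_pmulr // expn_gt0 t_gt0.
have s_gt0 : (0 < s)%N by apply: leq_trans s_ge4.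
elim/ltn_ind: n S => n IH S Sn nogrid.
have [n_lt|s_le] := ltnP n s.
  have : (#|S| <= n * n)%N.
    apply: (@leq_trans #|setX [set i : 'I_N | (i < n)%N] [set i : 'I_N | (i < n)%N]|).
      by apply: subset_leq_card; apply/fintype.subsetP => -[p q] /Sn /= h; rewrite !inE.
    by rewrite cardsX leq_mul ?card_ord_ltn.
  by move/leq_trans; apply; rewrite leq_mul2r /c; apply/orP; right; lia.
pose B (p : 'I_N * 'I_N) := (block s p.1, block s p.2).
pose n' := (n %/ s).+1.
have n'_le : (s * n' <= 2 * n)%N.
  rewrite /n' mulnS mulnC (leq_trans (leq_add s_le (leq_trunc_div n s))) //.
  by rewrite addnn mul2n.
have n'_lt : (2 * n' <= n)%N.
  by rewrite -(@leq_pmul2l 2) // (leq_trans _ n'_le) // mulnA leq_mul2r s_ge4 orbT.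
have Bn p : p \in B @: S -> (p.1 < n')%N && (p.2 < n')%N.
  case/imsetP => q /Sn /andP[q1 q2] -> /=; rewrite /n' !ltnS.
  by rewrite !leq_div2r // ltnW.
have cB : (#|B @: S| <= c * n')%N.
  apply: IH => //; first by lia.
  (* A grid of blocks pulls back to a grid of points, since division by [s] is monotone. *)
  apply: contra_not nogrid; apply: (@has_grid_map (fun i => i %/ s)%N).
    by move=> i j ij; apply: leq_div2r.
  move=> i j [p /imsetP[q qS ->] [<- <-]]; exists (q.1), (q.2).
  by split=> //; exists q.
pose F b := [set p in S | B p == b].
pose cols b := block_cols s S fst snd b.1 b.2.
pose rows b := block_cols s S snd fst b.2 b.1.
have FE b : F b \subset setX (rows b) (cols b).
  apply/fintype.subsetP => -[p q]; rewrite !inE => /andP[pS /eqP <-] /=.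
  by apply/andP; split; apply/imsetP; exists (p, q); rewrite ?inE ?pS ?eqxx.
have wide : (#|[set b in B @: S | (t <= #|cols b|)%N]| <= n' * D)%N.
  apply: leq_trans (leq_mul (card_ord_ltn N n') (leqnn _)).
  apply: (@leq_card_fibers _ _ snd) => [b|J _].
    by rewrite !inE => /andP[/Bn/andP[]].
  apply: leq_trans (@wide_blocks _ _ s_gt0 _ S fst snd t J t_gt0 nogrid).
  rewrite -(card_in_imset (f := fst)).
    apply: subset_leq_card; apply/fintype.subsetP => I /imsetP[b].
    by rewrite !inE => /andP[/andP[_ h] /eqP <-] ->.
  move=> [b1 b2] [b1' b2']; rewrite !inE => /andP[_ /eqP/= ->] /andP[_ /eqP/= ->].
  by move=> ->.
(* The same count after exchanging the coordinates. *)
have tall : (#|[set b in B @: S | (t <= #|rows b|)%N]| <= n' * D)%N.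
  apply: leq_trans (leq_mul (card_ord_ltn N n') (leqnn _)).
  apply: (@leq_card_fibers _ _ fst) => [b|J _].
    by rewrite !inE => /andP[/Bn/andP[]].
  have nogrid' : ~ has_grid t (fun i j => exists2 p, p \in S &
      (p.2 = i :> nat) /\ (p.1 = j :> nat)).
    apply: contra_not nogrid => /has_grid_swap; apply: (@has_grid_map id) => //.
    by move=> i j [p pS [pi pj]]; exists i, j; split=> //; exists p.
  apply: leq_trans (@wide_blocks _ _ s_gt0 _ S snd fst t J t_gt0 nogrid').
  rewrite -(card_in_imset (f := snd)).
    apply: subset_leq_card; apply/fintype.subsetP => I /imsetP[b].
    by rewrite !inE => /andP[/andP[_ h] /eqP <-] ->.
  move=> [b1 b2] [b1' b2']; rewrite !inE => /andP[_ /eqP/= ->] /andP[_ /eqP/= ->].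
  by move=> ->.
have Fb b : (#|F b| <= t ^ 2 + (t <= #|cols b|) * s ^ 2 + (t <= #|rows b|) * s ^ 2)%N.
  have := subset_leq_card (FE b); rewrite cardsX => /leq_trans; apply.
  have : (#|rows b| * #|cols b| <= s ^ 2)%N by rewrite leq_mul ?card_block_cols.
  have [c1|c1] := leqP t #|cols b|; have [c2|c2] := leqP t #|rows b|;
    rewrite /= ?mul1n ?mul0n; move=> h; try by apply: leq_trans h _; lia.
  by rewrite !addn0 -mulnn leq_mul // ltnW.
have : (#|S| <= t ^ 2 * #|B @: S| + (n' * D) * s ^ 2 + (n' * D) * s ^ 2)%N.
  rewrite -sum1_card (partition_big B (mem (B @: S))) /=; last first.
    by move=> p pS; apply: imset_f.
  apply: (@leq_trans (\sum_(b in B @: S)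
     (t ^ 2 + (t <= #|cols b|) * s ^ 2 + (t <= #|rows b|) * s ^ 2))).
    apply: leq_sum => b _; apply: leq_trans (Fb b); rewrite -sum1_card.
    by apply/eq_leq/eq_bigl => p; rewrite inE.
  rewrite !big_split /= sum_nat_const mulnC -!big_distrl /=.
  have cE (P : pred ('I_N * 'I_N)) :
      \sum_(b in B @: S) (P b : nat) = #|[set b in B @: S | P b]|.
    rewrite -sum1_card [RHS](eq_bigl (fun b => (b \in B @: S) && P b)); last first.
      by move=> b; rewrite inE.
    by rewrite big_mkcondr; apply: eq_bigr => b _; case: (P b).
  by rewrite !cE !leq_add // leq_mul2r ?wide ?tall orbT.
move/leq_trans; apply.
have tn' : (2 * (t ^ 2 * n') <= n)%N by move: n'_le; rewrite /s; lia.
have h1 : (2 * (t ^ 2 * #|B @: S|) <= c * n)%N.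
  apply: leq_trans (leq_mul (leqnn c) tn').
  rewrite [X in (_ <= X)%N]mulnCA leq_mul2l /= [X in (_ <= X)%N]mulnCA.
  by rewrite leq_mul2l cB orbT.
have h2 : (2 * (n' * D * s ^ 2 + n' * D * s ^ 2) <= c * n)%N.
  have : (c * (2 * n') <= c * n)%N by rewrite leq_mul2l n'_lt orbT.
  apply: leq_trans; rewrite /c; clearbody D s n'; nia.
lia.
Qed.

(** * Merging consecutive intervals of a chord diagram *)

Definition crossing (a b c d : nat) : bool :=
  [&& a < c, c < b & b < d]%N || [&& c < a, a < d & d < b]%N.

Lemma sum_nat_eq_op x m : (\sum_(i < m) (x == i :> nat) <= 1)%N.
Proof.
suff -> : \sum_(i < m) (x == i :> nat) = (x < m)%N by apply: leq_b1.
elim: m => [|m IH]; first by rewrite big_ord0.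
by rewrite big_ord_recr /= IH; lia.
Qed.

Definition merge_nat (i j : nat) : nat := if (j <= i)%N then j else j.-1.

Lemma merge_nat_homo i : {homo merge_nat i : x y / (x <= y)%N}.
Proof. by rewrite /merge_nat => x y xy; case: (leqP x i); case: (leqP y i); lia. Qed.

Section Touching.
Variables (N : nat) (S : {set 'I_N * 'I_N}).

Definition touching (i : nat) : {set 'I_N * 'I_N} :=
  [set p in S | (p.1 == i :> nat) || (p.2 == i :> nat)].

Lemma sum_touching m : (\sum_(i < m) #|touching i| <= 2 * #|S|)%N.
Proof.
apply: (@leq_trans (\sum_(i < m) \sum_(p in S) ((p.1 == i :> nat) + (p.2 == i :> nat)))).
  apply: leq_sum => i _; rewrite -sum1_card big_mkcond [X in (_ <= X)%N]big_mkcond /=.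
  by apply: leq_sum => p _; rewrite inE; case: (p \in S) => //=; do 2!case: eqP.
rewrite exchange_big /= mulnC -sum_nat_const; apply: leq_sum => p _.
by rewrite big_split; apply: (@leq_add _ _ 1 1); apply: sum_nat_eq_op.
Qed.

(** Averaging: a point touches at most two indices, so the sums over consecutive pairs total at most
    [4 * c * m], and there are [m - 1], hence at least [m / 2], pairs. *)
Lemma merge_exists m c : (1 < m)%N -> (#|S| <= c * m)%N ->
  exists2 i, (i.+1 < m)%N & (#|touching i| + #|touching i.+1| <= 8 * c)%N.
Proof.
case: m => [|[|m]] // _ Sc.
have [h|/forallNP h] := pselect (exists i : 'I_m.+1,
    (#|touching i| + #|touching i.+1| <= 8 * c)%N).
  by case: h => i h; exists i => //; exact: ltn_ord i.
have h1 : (\sum_(i < m.+1) (8 * c).+1 <= \sum_(i < m.+1) (#|touching i| + #|touching i.+1|))%N.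
  by apply: leq_sum => i _; rewrite ltnNge; apply/negP/h.
move: h1; rewrite sum_nat_const card_ord big_split /=.
have s1 := sum_touching m.+1; have s2 := sum_touching m.+2.
rewrite big_ord_recl /= in s2.
have -> : \sum_(i < m.+1) #|touching i.+1| = \sum_(i < m.+1) #|touching (bump 0 i)|.
  by apply: eq_bigr => i _; rewrite /bump.
set x := \sum_(i < m.+1) _ in s1 *; set y := \sum_(i < m.+1) _ in s2 *.
move: (#|S|) Sc s1 s2 => z; nia.
Qed.
End Touching.

Section Merging.
Variables (G : sgraph) (N q t : nat) (kappa : G -> 'I_q.+1).
Variable e : 'I_q.+1 -> 'I_q.+1 -> bool.
Hypothesis t_gt0 : (0 < t)%N.

Definition spots (L R : G -> 'I_N) : {set 'I_N * 'I_N} := [set (L v, R v) | v : G].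

Definition parts (L R : G -> 'I_N) (v : G) : 'I_N * 'I_N * 'I_q.+1 :=
  ((L v, R v), kappa v).

Let B := (8 * marcus_tardos_constant t)%N.

(** [L] and [R] name the intervals containing the two ends of a chord. Adjacency is prescribed only
    for chords without a common interval, since the order of ends inside one interval is lost by
    merging. *)
Record good_labels (m : nat) (L R : G -> 'I_N) : Prop := GoodLabels {
  labels_lt : forall v, (L v < m)%N && (R v < m)%N;
  labels_adj : forall u v, L u != L v -> L u != R v -> R u != L v -> R u != R v ->
    adj u v = crossing (L u) (R u) (L v) (R v) (+) e (kappa u) (kappa v);
  labels_no_grid : ~ has_grid t (cells (spots L R));
  labels_deg : forall i, (#|touching (spots L R) i| <= B)%N }.

(** Parts without a common interval are homogeneous by [labels_adj]; the cells sharing one of two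
    given intervals number at most [2 * B], each in [q.+1] colours. *)
Lemma good_red_bounded m L R : good_labels m L R ->
  red_bounded (q.+1 * (2 * B)) (parts L R).
Proof.
move=> [_ adjE _ degB] [[a b] k].
apply: (@leq_trans #|setX (touching (spots L R) a :|: touching (spots L R) b)
                        [set: 'I_q.+1]|); last first.
  rewrite cardsX cardsT card_ord mulnC leq_mul2l; apply/orP; right.
  rewrite mul2n -addnn (leq_trans _ (leq_add (degB a) (degB b))) //.
  by rewrite cardsU leq_subr.
apply: subset_leq_card; apply/fintype.subsetP => -[[a' b'] k'].
rewrite !inE andbT => /andP[_ /asboolP mx].
case: mx => -[u [v [[Lu Ru ku] [Lv Rv kv] uv]]] [u' [v' [[Lu' Ru' ku'] [Lv' Rv' kv'] uv']]].
have -> : (a', b') \in spots L R by apply/imsetP; exists v; rewrite ?Lv ?Rv.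
rewrite /=.
apply: contraNT uv'; rewrite !negb_or => /andP[/andP[n1 n2] /andP[n3 n4]].
move: uv; rewrite !adjE ?Lu ?Ru ?Lv ?Rv ?Lu' ?Ru' ?Lv' ?Rv' ?ku ?kv ?ku' ?kv' //.
all: by rewrite -(inj_eq val_inj) eq_sym.
Qed.

Lemma merge_subproof i (j : 'I_N) : (merge_nat i j < N)%N.
Proof. by rewrite /merge_nat; case: ifP => // _; have := ltn_ord j; lia. Qed.

Definition merge i (j : 'I_N) : 'I_N := Ordinal (merge_subproof i j).

Lemma card_merge_fiber i x : (#|[set j | merge i j == x]| <= 2)%N.
Proof.
apply: (@leq_trans #|[set j : 'I_N | (j == x :> nat)] :|:
                      [set j : 'I_N | (j == x.+1 :> nat)]|).
  apply: subset_leq_card; apply/fintype.subsetP => j.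
  by rewrite !inE -(inj_eq val_inj) /= /merge_nat; case: leqP; lia.
have c1 y : (#|[set j : 'I_N | (j == y :> nat)]| <= 1)%N.
  apply/card_le1_eqP => j j'; rewrite !inE => /eqP jy /eqP j'y.
  by apply/val_inj; rewrite /= jy.
by rewrite cardsU (leq_trans (leq_subr _ _)) // (leq_add (c1 _) (c1 _)).
Qed.

(** Each of the two labels has at most two preimages and the colour is kept, which gives four parts;
    the factor [q.+1] leaves room for the last step of [good_realizable], which joins all
    colours. *)
Lemma merge_refines i L R :
  refines (4 * q.+1) (parts L R) (parts (merge i \o L) (merge i \o R)).
Proof.
split=> [u v [Luv Ruv kuv]|[[a b] k]]; first by rewrite /parts /= Luv Ruv kuv.
apply: (@leq_trans #|setX (setX [set j | merge i j == a] [set j | merge i j == b]) [set k]|).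
  apply: subset_leq_card; apply/fintype.subsetP => x /imsetP[v].
  by rewrite !inE => /eqP[<- <- <-] ->; rewrite !eqxx.
have c2 x : (#|[set j | merge i j == x]| <= 2)%N by apply: card_merge_fiber.
rewrite !cardsX cards1 muln1 (leq_trans (leq_mul (c2 _) (c2 _))) //.
by rewrite leq_pmulr.
Qed.

(** Labels that stay distinct keep their order, so crossings do not change, and a grid of merged
    cells pulls back. Only the new interval [i] can touch more cells, and its bound is assumed. *)
Lemma good_merge m L R i : good_labels m.+2 L R -> (i.+1 < m.+2)%N ->
  (#|touching (spots L R) i| + #|touching (spots L R) i.+1| <= B)%N ->
  good_labels m.+1 (merge i \o L) (merge i \o R).
Proof.
move=> [lt adjE nogrid degB] im degi; split.
- move=> v; move: (lt v) => /=; rewrite /merge_nat.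
  by case: (leqP (L v) i); case: (leqP (R v) i); lia.
- have mergeN x y : merge i x != merge i y -> x != y by apply: contraNneq => ->.
  have homoE x y : merge i x != merge i y -> (merge_nat i x < merge_nat i y)%N = (x < y)%N.
    by rewrite -(inj_eq val_inj) /= /merge_nat; case: (leqP x i); case: (leqP y i); lia.
  move=> u v h1 h2 h3 h4; rewrite adjE; try exact: mergeN; rewrite /crossing /=.
  rewrite (homoE (L u) (L v)) // (homoE (R u) (R v)) // (homoE (L u) (R v)) //.
  by rewrite (homoE (L v) (R u)) 1?eq_sym // (homoE (L v) (L u)) 1?eq_sym //
    (homoE (R v) (R u)) 1?eq_sym.
- apply: contra_not nogrid; apply: (@has_grid_map (merge_nat i)).
    exact: merge_nat_homo.
  move=> x y [p /imsetP[v _ ->] /= [<- <-]]; exists (L v), (R v); split=> //.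
  by exists (L v, R v) => //; apply: imset_f.
- move=> j.
  (* The old cells whose images touch [j]; the interval [j = i] has the two preimages [i] and
     [i.+1]. *)
  pose J := touching (spots L R) (if (j <= i)%N then j else j.+1) :|:
    (if j == i then touching (spots L R) i.+1 else finset.set0).
  have JB : (#|J| <= B)%N.
    rewrite /J; case: (ltngtP j i) => [|| ->]; rewrite ?finset.setU0 //.
    by rewrite (leq_trans _ degi) // cardsU leq_subr.
  apply: leq_trans JB.
  apply: leq_trans (leq_imset_card (fun p => (merge i p.1, merge i p.2)) _).
  apply: subset_leq_card; apply/fintype.subsetP => p.
  rewrite inE => /andP[/imsetP[v _ ->] /= h].
  apply/imsetP; exists (L v, R v) => //.
  have vS : (L v, R v) \in spots L R by apply: imset_f.
  move: h; rewrite /J /merge_nat; case: (ltngtP j i) => ji; rewrite !inE vS /=;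
    case: (leqP (L v) i); case: (leqP (R v) i); lia.
Qed.

Lemma good_realizable m L R : good_labels m L R ->
  realizable (q.+1 * (2 * B)) (4 * q.+1) (parts L R).
Proof.
elim: m L R => [|[|m] IH] L R gL.
- apply: realizable_const; first exact: good_red_bounded gL.
  by move=> u; have := labels_lt gL u.
(* With one interval left there is one cell; only the colours distinguish parts, and [g] forgets
   them. *)
- pose g v : 'I_N * 'I_N * 'I_q.+1 := (L v, R v, ord0).
  have gE u v : g u = g v.
    have := labels_lt gL u; have := labels_lt gL v; rewrite !ltnS !leqn0.
    move=> /andP[/eqP Lv /eqP Rv] /andP[/eqP Lu /eqP Ru].
    by congr (_, _, _); apply/val_inj; rewrite /= ?Lu ?Ru.
  apply: (@realizable_step _ _ _ _ _ g); first exact: good_red_bounded gL.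
    split=> // x.
    rewrite (leq_trans (@leq_card_fibers _ _ (fun y => y.2) _ [set: 'I_q.+1] 1 _ _)) //.
    + move=> k _; apply/card_le1_eqP => y y'; rewrite !inE.
      move=> /andP[/imsetP[v _ ->] /eqP/= kv] /andP[/imsetP[v' _ ->] /eqP/= kv'].
      by case: (gE v v') => Lv Rv; rewrite /parts Lv Rv kv kv'.
    + by rewrite cardsT card_ord; lia.
  apply: realizable_const => // x.
  rewrite (eq_card0 (A := finset _)) // => y; rewrite !inE.
  apply/negP => /andP[/eqP yx /asboolP[[u [v [gu gv _]]] _]].
  by apply: yx; rewrite -gu -gv.
- have lt := labels_lt gL.
  have [|i im degi] := @merge_exists _ (spots L R) m.+2 (marcus_tardos_constant t) isT.
    apply: marcus_tardos => //; last exact: labels_no_grid gL.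
    by move=> p /imsetP[v _ ->]; exact: lt.
  apply: (realizable_step (good_red_bounded gL) (merge_refines i L R)).
  by apply: IH; apply: good_merge.
Qed.

Lemma good_twin_width m L R : good_labels m L R -> injective (parts L R) ->
  (twin_width G <= 4 * q.+1 * (q.+1 * (2 * B)).+1)%N.
Proof.
move=> gL injp; apply/twin_width_leP.
apply: (good_realizable gL).2 (quotient_id G) _; split=> [u v -> //|x].
apply: (@leq_trans 1) => //; apply/card_le1_eqP => y y' /imsetP[v + ->] /imsetP[v' + ->].
by rewrite !inE => /eqP <- /eqP /injp ->.
Qed.
End Merging.

Definition twin_width_constant (q t : nat) : nat :=
  4 * q.+1 * (q.+1 * (2 * (8 * marcus_tardos_constant t))).+1.

Lemma diagram_twin_width (G : sgraph) (q t : nat) (l r : G -> nat)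
    (kappa : G -> 'I_q.+1) (e : 'I_q.+1 -> 'I_q.+1 -> bool) : (0 < t)%N ->
  injective l -> injective r -> (forall u v, l u <> r v) ->
  (forall u v, u != v ->
     adj u v = crossing (l u) (r u) (l v) (r v) (+) e (kappa u) (kappa v)) ->
  ~ has_grid t (fun i j => exists v, l v = i /\ r v = j) ->
  (twin_width G <= twin_width_constant q t)%N.
Proof.
move=> t_gt0 injl injr lr adjE nogrid.
pose N := \max_(v : G) maxn (l v) (r v).
have lN v : (l v < N.+1)%N.
  by rewrite ltnS (leq_trans (leq_maxl _ (r v))) // (leq_bigmax v).
have rN v : (r v < N.+1)%N.
  by rewrite ltnS (leq_trans (leq_maxr (l v) _)) // (leq_bigmax v).
pose L v := Ordinal (lN v); pose R v := Ordinal (rN v).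
apply: (@good_twin_width G N.+1 q t kappa e t_gt0 N.+1 L R); last first.
  by move=> u v [/injl].
split=> [v|u v n1 _ _ _||i].
- by rewrite !ltn_ord.
- by apply: adjE; apply: contraNneq n1 => ->.
- apply: contra_not nogrid; apply: (@has_grid_map id) => // i j.
  case=> p /imsetP[v _ ->] /= [<- <-]; exists (l v), (r v); split=> //.
  by exists v.
(* All ends are distinct, so initially an index touches at most one cell. *)
- apply: (@leq_trans 1).
    apply/card_le1_eqP => p p'; rewrite !inE.
    move=> /andP[/imsetP[v _ ->] h] /andP[/imsetP[v' _ ->] h'].
    suff -> : v = v' by [].
    move: h h' => /=; have := lr v v'; have := lr v' v.
    move=> ? ? /orP[]/eqP hv /orP[]/eqP hv'; try congruence.
      by apply: injl; rewrite hv.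
    by apply: injr; rewrite hv.
  rewrite /marcus_tardos_constant; have : (0 < 4 * t ^ 2)%N by rewrite muln_gt0 expn_gt0 t_gt0.
  lia.
Qed.

(** * Chord diagrams with pairwise distinct ends *)

Section Rank.
Variables (E : finType) (d : Order.disp_t) (O : orderType d) (key : E -> O).
Local Open Scope order_scope.

Definition rank (e : E) : nat := #|[set e' | key e' < key e]|.

Lemma rank_lt e e' : (rank e < rank e')%N = (key e < key e').
Proof.
have mono x y : key x <= key y -> (rank x <= rank y)%N.
  move=> xy; apply: subset_leq_card; apply/fintype.subsetP => z.
  by rewrite !inE => /lt_le_trans; apply.
case: ltP => [lt|/mono]; last by rewrite leqNgt => /negbTE.
apply/proper_card/fintype.properP; split.
  by apply/fintype.subsetP => z; rewrite !inE => /lt_trans; apply.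
by exists e; rewrite !inE ?ltxx.
Qed.

Lemma rank_bound e : (rank e < #|E|)%N.
Proof.
rewrite -cardsT; apply/proper_card/fintype.properP; split.
  by apply/fintype.subsetP.
by exists e; rewrite !inE ?ltxx.
Qed.

Lemma rank_inj : injective key -> injective rank.
Proof.
move=> injk x y xy; apply/injk/eqP; rewrite eq_le !leNgt -!rank_lt.
by rewrite xy ltnn.
Qed.
End Rank.

Local Open Scope ring_scope.

Section TieBreaking.
Variables (R : realType) (V : finType) (lo hi : V -> R).
Hypothesis lo_hi : forall v, lo v < hi v.

Definition weakly_crossing (a b c d : R) : bool :=
  [&& a <= c, c <= b & b <= d] || [&& c <= a, a <= d & d <= b].

(* At a common point, left ends precede right ends and ends of the same kind
   are sorted by the opposite end, so that touching chords cross. *)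
Definition end_key (x : V * bool) : R *l (bool *l (R *l 'I_#|V|)) :=
  if x.2 then (hi x.1, (true, (lo x.1, enum_rank x.1)))
  else (lo x.1, (false, (hi x.1, enum_rank x.1))).

Lemma end_key_inj : injective end_key.
Proof.
by move=> [u []] [v []] // [] _ _ /(congr1 val)/val_inj/enum_rank_inj ->.
Qed.

Lemma end_key_left u v : (end_key (u, false) < end_key (v, false))%O =
  (lo u <= lo v) && ((lo v <= lo u) ==>
    (hi u <= hi v) && ((hi v <= hi u) ==> (enum_rank u < enum_rank v)%O)).
Proof. by []. Qed.

Lemma end_key_right u v : (end_key (u, true) < end_key (v, true))%O =
  (hi u <= hi v) && ((hi v <= hi u) ==>
    (lo u <= lo v) && ((lo v <= lo u) ==> (enum_rank u < enum_rank v)%O)).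
Proof. by []. Qed.

Lemma end_key_left_right u v :
  (end_key (u, false) < end_key (v, true))%O = (lo u <= hi v).
(* The right side takes the shape to which the lexicographic order computes, a tie being decided by
   [false < true]. *)
Proof. by rewrite -[RHS]andbT -[X in _ && X](implybT (hi v <= lo u)). Qed.

Definition end_rank (x : V * bool) : nat := rank end_key x.

Lemma end_rank_inj : injective end_rank.
Proof. exact: rank_inj end_key_inj. Qed.

Lemma end_rank_left_right v : (end_rank (v, false) < end_rank (v, true))%N.
Proof. by rewrite rank_lt end_key_left_right ltW. Qed.

(** Each coincidence of ends is resolved in favour of crossing; for equal chords, [enum_rank] orders
    left ends and right ends alike. *)
Lemma end_rank_crossing u v : u != v ->
  crossing (end_rank (u, false)) (end_rank (u, true))
           (end_rank (v, false)) (end_rank (v, true)) =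
  weakly_crossing (lo u) (hi u) (lo v) (hi v).
Proof.
have rkE x y : (end_rank x < end_rank y)%N = (end_key x < end_key y)%O.
  exact: rank_lt.
move=> uv.
have e1 := etrans (rkE (u, false) (v, false)) (end_key_left u v).
have e2 := etrans (rkE (v, false) (u, false)) (end_key_left v u).
have e3 := etrans (rkE (u, true) (v, true)) (end_key_right u v).
have e4 := etrans (rkE (v, true) (u, true)) (end_key_right v u).
have e5 := etrans (rkE (u, false) (v, true)) (end_key_left_right u v).
have e6 := etrans (rkE (v, false) (u, true)) (end_key_left_right v u).
move: (end_rank (u, false)) (end_rank (u, true)) e1 e2 e3 e4 e5 e6.
move: (end_rank (v, false)) (end_rank (v, true)) => lv rv lu ru e1 e2 e3 e4 e5 e6.
rewrite /crossing e1 e2 e3 e4 e5 e6 /weakly_crossing.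
have := lo_hi u; have := lo_hi v.
have : enum_rank u != enum_rank v by rewrite (inj_eq enum_rank_inj).
move: (enum_rank u) (enum_rank v) (lo u) (lo v) (hi u) (hi v).
move=> i j a c b d {e1 e2 e3 e4 e5 e6 rkE}.
case: (ltgtP i j) => // _ _ cd ab;
case: (ltgtP a c) => h1; case: (ltgtP b d) => h2 //=;
case: (ltgtP a d) => h3; case: (ltgtP c b) => h4 //=; lra.
Qed.
End TieBreaking.

(** * Intersection of chords of the unit circle *)

Section Geometry.
Variable R : realType.
Implicit Types a b c d z : R * R.

(** Twice the signed area of the triangle [a b c]; the sign tells the side of the line [a b] on
    which [c] lies. *)
Definition orient a b c : R :=
  (b.1 - a.1) * (c.2 - a.2) - (b.2 - a.2) * (c.1 - a.1).

Lemma segment_sym a b : segment a b = segment b a.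
Proof.
suff h a' b' z : segment a' b' z -> segment b' a' z.
  by apply/seteqP; split=> z; apply: h.
move=> [t /andP[t0 t1] ->]; exists (1 - t); first by apply/andP; split; lra.
by congr (_, _); ring.
Qed.

Lemma segment_orient a b z : unit_circle a -> unit_circle b -> a <> b ->
  orient a b z = 0 -> z.1 ^+ 2 + z.2 ^+ 2 <= 1 -> segment a b z.
Proof.
case: a b z => [a1 a2] [b1 b2] [z1 z2]; rewrite /unit_circle /orient /=.
move=> ha hb ab oz hz.
pose n := (b1 - a1) ^+ 2 + (b2 - a2) ^+ 2.
have n_gt0 : 0 < n.
  rewrite lt_def addr_ge0 ?sqr_ge0 // andbT paddr_eq0 ?sqr_ge0 // !sqrf_eq0 !subr_eq0.
  by apply/negP => /andP[/eqP e1 /eqP e2]; apply: ab; rewrite e1 e2.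
have n0 : n != 0 by rewrite gt_eqF.
pose w := (z1 - a1) * (b1 - a1) + (z2 - a2) * (b2 - a2).
pose s := w / n.
have coordE x y : n * ((1 - s) * x + s * y) = n * x + w * (y - x).
  by rewrite /s; field.
have e1 : z1 = (1 - s) * a1 + s * b1.
  apply: (mulfI n0); rewrite coordE /w.
  apply/eqP; rewrite -subr_eq0; apply/eqP; rewrite /n.
  transitivity (- (b2 - a2) * ((b1 - a1) * (z2 - a2) - (b2 - a2) * (z1 - a1))).
    by ring.
  by rewrite oz mulr0.
have e2 : z2 = (1 - s) * a2 + s * b2.
  apply: (mulfI n0); rewrite coordE /w.
  apply/eqP; rewrite -subr_eq0; apply/eqP; rewrite /n.
  transitivity ((b1 - a1) * ((b1 - a1) * (z2 - a2) - (b2 - a2) * (z1 - a1))).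
    by ring.
  by rewrite oz mulr0.
(* For [a] and [b] on the circle this product is the squared norm of [z] minus 1, so a point of the
   line inside the disc has its parameter in [[0, 1]]. *)
have hs : (s ^+ 2 - s) * n <= 0.
  have -> : (s ^+ 2 - s) * n = z1 ^+ 2 + z2 ^+ 2 - 1
     - (1 - s) * (a1 ^+ 2 + a2 ^+ 2 - 1) - s * (b1 ^+ 2 + b2 ^+ 2 - 1).
    by rewrite e1 e2 /n; ring.
  by rewrite ha hb; lra.
exists s; last by rewrite -e1 -e2.
rewrite pmulr_lle0 // in hs.
by apply/andP; split; nra.
Qed.

(** Conversely, the affine function [orient a b] has a zero on [segment c d]; that point lies in the
    disc by convexity, hence on [segment a b] by [segment_orient]. *)
Lemma chords_meet a b c d : unit_circle a -> unit_circle b -> a <> b ->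
  unit_circle c -> unit_circle d ->
  (segment a b `&` segment c d !=set0)%classic <->
  orient a b c * orient a b d <= 0.
Proof.
move=> ha hb ab hc hd; split.
  case=> z [[s /andP[s0 s1] zs] [t /andP[t0 t1] zt]].
  have : (1 - t) * orient a b c + t * orient a b d = 0.
    transitivity (orient a b z); first by rewrite zt /orient /=; ring.
    by rewrite zs /orient /=; ring.
  set x := orient a b c; set y := orient a b d => {zs zt ab ha hb hc hd} h.
  rewrite leNgt; apply/negP => xy.
  have [x0|x0|x0] := ltgtP x 0; last by move: xy; rewrite x0 mul0r ltxx.
    have y0 : y < 0 by nra.
    by nra.
  have y0 : 0 < y by nra.
  by nra.
set x := orient a b c; set y := orient a b d => xy.
have [t /andP[t0 t1] tE] : exists2 t : R, 0 <= t <= 1 & (1 - t) * x + t * y = 0.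
  have [e|ne] := eqVneq x y.
    have x0 : x = 0.
      by apply/eqP; rewrite -sqrf_eq0 eq_le sqr_ge0 expr2 {2}e xy.
    by exists 0; [rewrite lexx ler01|rewrite -e x0 mulr0 mulr0 addr0].
  have ne0 : x - y != 0 by rewrite subr_eq0.
  clear ab ha hb hc hd; exists (x / (x - y)); last by field.
  have [xlt|xgt|e] := ltgtP x y; last by rewrite e eqxx in ne.
    have x0 : x <= 0 by nra.
    have y0 : 0 <= y by nra.
    by rewrite ler_ndivlMr ?ler_ndivrMr ?subr_lt0 //; apply/andP; split; lra.
  have x0 : 0 <= x by nra.
  have y0 : y <= 0 by nra.
  by rewrite ler_pdivlMr ?ler_pdivrMr ?subr_gt0 //; apply/andP; split; lra.
exists ((1 - t) * c.1 + t * d.1, (1 - t) * c.2 + t * d.2); split; last first.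
  by exists t => //; rewrite t0.
apply: segment_orient => //=.
  by rewrite -tE /x /y /orient /=; ring.
have tt : 0 <= t * (1 - t) by apply: mulr_ge0; lra.
have -> : ((1 - t) * c.1 + t * d.1) ^+ 2 + ((1 - t) * c.2 + t * d.2) ^+ 2 =
   (1 - t) * (c.1 ^+ 2 + c.2 ^+ 2) + t * (d.1 ^+ 2 + d.2 ^+ 2)
   - t * (1 - t) * ((c.1 - d.1) ^+ 2 + (c.2 - d.2) ^+ 2) by ring.
have n0 : 0 <= (c.1 - d.1) ^+ 2 + (c.2 - d.2) ^+ 2 by rewrite addr_ge0 ?sqr_ge0.
have := mulr_ge0 tt n0; rewrite hc hd => h; rewrite -subr_ge0.
by apply: (le_trans h); rewrite le_eqVlt; apply/orP; left; apply/eqP; ring.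
Qed.

(* Homogeneous stereographic coordinates of a point of the circle from (-1, 0). *)
Definition stereo_p z : R := if z.1 == -1 then 1 else z.2 / (1 + z.1).
Definition stereo_q z : R := if z.1 == -1 then 0 else 1.

Definition stereo_det a b : R := stereo_p b * stereo_q a - stereo_p a * stereo_q b.

Lemma stereoE z : unit_circle z ->
  exists n, [/\ 0 < n, n = stereo_p z ^+ 2 + stereo_q z ^+ 2,
     z.1 = (stereo_q z ^+ 2 - stereo_p z ^+ 2) / n & z.2 = 2 * stereo_p z * stereo_q z / n].
Proof.
case: z => x y; rewrite /unit_circle /stereo_p /stereo_q /= => h.
exists (if x == -1 then 1 else (y / (1 + x)) ^+ 2 + 1).
have [e|ne] := eqVneq x (-1).
  split; [lra|ring|lra|].
  have /eqP : y ^+ 2 = 0 by move: h; rewrite e; lra.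
  by rewrite sqrf_eq0 => /eqP ->; ring.
have ne0 : 1 + x != 0 by rewrite addrC addr_eq0.
have y2 : y ^+ 2 = (1 - x) * (1 + x).
  apply/eqP; rewrite -subr_eq0; apply/eqP.
  by transitivity (x ^+ 2 + y ^+ 2 - 1); [ring|rewrite h subrr].
have p2 : (y / (1 + x)) ^+ 2 = (1 - x) / (1 + x).
  by rewrite expr_div_n y2; field.
rewrite p2.
have n2 : (1 - x) / (1 + x) + 1 = 2 / (1 + x) by field.
rewrite n2 expr1n; split=> //.
- have : 0 <= (1 - x) / (1 + x) by rewrite -p2 sqr_ge0.
  by rewrite -n2; lra.
- by field; rewrite ne0.
- by field; rewrite ne0.
Qed.

(** The coordinates are quadratic forms in [stereo_p] and [stereo_q] over a common norm, so the
    orientation is a homogeneous Vandermonde determinant. *)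
Lemma orient_stereo a b c : unit_circle a -> unit_circle b -> unit_circle c ->
  exists2 m, 0 < m &
  orient a b c = m * (stereo_det a b * stereo_det b c * stereo_det a c).
Proof.
move=> /stereoE[na [na0 naE a1 a2]] /stereoE[nb [nb0 nbE b1 b2]] /stereoE[nc [nc0 ncE c1 c2]].
exists (4 / (na * nb * nc)); first by rewrite divr_gt0 ?mulr_gt0.
rewrite /orient a1 a2 b1 b2 c1 c2 /stereo_det.
have na1 : na != 0 by rewrite gt_eqF.
have nb1 : nb != 0 by rewrite gt_eqF.
have nc1 : nc != 0 by rewrite gt_eqF.
move: naE nbE ncE na1 nb1 nc1.
move: (stereo_p a) (stereo_q a) (stereo_p b) (stereo_q b) (stereo_p c) (stereo_q c).
move=> pa qa pb qb pc qc -> -> -> na1 nb1 nc1.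
by field; rewrite na1 nb1 nc1.
Qed.

(** The circle is cut open at [(-1, 0)], whose infinite parameter is replaced by a large value
    [M]. *)
Definition stereo_key (M : R) z : R := if z.1 == -1 then M else stereo_p z.

Lemma sgr_stereo_det M a b : stereo_p a < M -> stereo_p b < M ->
  Num.sg (stereo_det a b) = Num.sg (stereo_key M b - stereo_key M a).
Proof.
rewrite /stereo_det /stereo_key /stereo_p /stereo_q.
case: ifP => ha; case: ifP => hb; rewrite ?mulr0 ?mul0r ?mulr1 ?mul1r ?subr0 ?sub0r ?subrr //.
- by move=> h1 h2; rewrite !ltr0_sg //; lra.
- by move=> h1 h2; rewrite !gtr0_sg //; lra.
Qed.

Lemma stereo_key_inj M a b : unit_circle a -> unit_circle b ->
  stereo_p a < M -> stereo_p b < M -> stereo_key M a = stereo_key M b -> a = b.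
Proof.
move=> /stereoE[na [na0 naE a1 a2]] /stereoE[nb [nb0 nbE b1 b2]] ha hb ab.
have [pE qE] : stereo_p a = stereo_p b /\ stereo_q a = stereo_q b.
  move: ha hb ab; rewrite /stereo_key /stereo_p /stereo_q.
  by case: ifP => ha; case: ifP => hb; move=> h1 h2 ab; split=> //; lra.
rewrite [a]surjective_pairing [b]surjective_pairing a1 a2 b1 b2 pE qE.
by rewrite naE nbE pE qE.
Qed.

(** Only signs matter: in the keys, the product of the two orientations has the sign of
    [(c - a) * (c - b) * (d - a) * (d - b)]. *)
Lemma chords_meet_key M a b c d :
  unit_circle a -> unit_circle b -> unit_circle c -> unit_circle d ->
  [&& stereo_p a < M, stereo_p b < M, stereo_p c < M & stereo_p d < M] ->
  stereo_key M a < stereo_key M b -> stereo_key M c < stereo_key M d ->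
  (segment a b `&` segment c d !=set0)%classic <->
  weakly_crossing (stereo_key M a) (stereo_key M b) (stereo_key M c) (stereo_key M d).
Proof.
move=> ha hb hc hd /and4P[Ma Mb Mc Md] ab cd.
have nab : a <> b by move=> e; rewrite e ltxx in ab.
rewrite chords_meet //.
have [m1 m1_gt0 ->] := orient_stereo ha hb hc.
have [m2 m2_gt0 ->] := orient_stereo ha hb hd.
rewrite -sgr_le0 !sgrM !(sgr_stereo_det (M := M)) //.
rewrite (gtr0_sg m1_gt0) (gtr0_sg m2_gt0) !mul1r.
move: ab cd; move: (stereo_key M a) (stereo_key M b) (stereo_key M c) (stereo_key M d).
move=> ka kb kc kd ab cd; rewrite (gtr0_sg (_ : 0 < kb - ka)) ?subr_gt0 // !mul1r.
have sgE x y : Num.sg (y - x) = if x < y then 1 else if x == y then 0 else -1 :> R.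
  case: ltgtP => [h|h|->]; last by rewrite subrr sgr0.
    by rewrite gtr0_sg ?subr_gt0.
  by rewrite ltr0_sg ?subr_lt0.
rewrite !sgE /weakly_crossing.
by case: (ltgtP kb kc) => h1; case: (ltgtP ka kc) => h2; case: (ltgtP kb kd) => h3;
  case: (ltgtP ka kd) => h4 //=;
  rewrite ?(mulr0, mul0r, mulr1, mul1r, mulrN, mulNr, opprK, ler01, lexx, lerN10, oppr0);
  split=> // h; lra.
Qed.
End Geometry.

Lemma circle_diagram (R : realType) (G : sgraph) : circle_graph R G ->
  exists l r : G -> nat, [/\ injective l, injective r,
    forall v, (l v < r v)%N, forall u v, l u <> r v &
    forall u v, u != v -> adj u v = crossing (l u) (r u) (l v) (r v)].
Proof.
move=> [c chordc adjE].
have /choice[f fE] : forall v, exists ab : (R * R) * (R * R),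
    [/\ unit_circle ab.1, unit_circle ab.2, ab.1 <> ab.2 & c v = segment ab.1 ab.2].
  by move=> v; have [a [b h]] := chordc v; exists (a, b).
(* A value above the parameters of all ends. *)
pose M := 1 + \sum_(v : G) (`|stereo_p (f v).1| + `|stereo_p (f v).2|).
have fM v : stereo_p (f v).1 < M /\ stereo_p (f v).2 < M.
  have : `|stereo_p (f v).1| + `|stereo_p (f v).2| < M.
    rewrite /M (bigD1 v) //=.
    have : 0 <= \sum_(i | i != v) (`|stereo_p (f i).1| + `|stereo_p (f i).2|).
      by apply: sumr_ge0 => i _; rewrite addr_ge0.
    lra.
  have := ler_norm (stereo_p (f v).1); have := ler_norm (stereo_p (f v).2).
  have := normr_ge0 (stereo_p (f v).1); have := normr_ge0 (stereo_p (f v).2).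
  by split; lra.
have /choice[g gE] : forall v, exists ab : (R * R) * (R * R),
    [/\ unit_circle ab.1 /\ unit_circle ab.2,
        stereo_p ab.1 < M /\ stereo_p ab.2 < M,
        stereo_key M ab.1 < stereo_key M ab.2 & c v = segment ab.1 ab.2].
  move=> v; have [h1 h2 h12 cv] := fE v; have [M1 M2] := fM v.
  have [lt|gt|e] := ltgtP (stereo_key M (f v).1) (stereo_key M (f v).2).
  - by exists (f v).
  - by exists ((f v).2, (f v).1); rewrite segment_sym.
  - by case: h12; apply: stereo_key_inj e.
pose lo v := stereo_key M (g v).1; pose hi v := stereo_key M (g v).2.
have lohi v : lo v < hi v by case: (gE v).
have injE := @end_rank_inj R G lo hi.
exists (fun v => end_rank lo hi (v, false)), (fun v => end_rank lo hi (v, true)).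
split.
- by move=> u v /injE[].
- by move=> u v /injE[].
- exact: end_rank_left_right.
- by move=> u v /injE.
- move=> u v uv; rewrite end_rank_crossing //.
  have [[gu1 gu2] [Mu1 Mu2] ku cu] := gE u; have [[gv1 gv2] [Mv1 Mv2] kv cv] := gE v.
  have W := chords_meet_key gu1 gu2 gv1 gv2 _ ku kv.
  apply/idP/idP => [/(adjE _ _ uv)|h].
    by rewrite cu cv => /W; apply; apply/and4P.
  by apply/(adjE _ _ uv); rewrite cu cv; apply/W => //; apply/and4P.
Qed.

(** * Permutation graphs inside large coloured grids *)

Local Open Scope nat_scope.

(* Cut the grid into n x n blocks: either some block misses the last colour,
   or every block contains it and the pattern can be placed block by block. *)
Lemma monochromatic_pattern (V : finType) (n q : nat) (X : V -> nat)
    (Y : nat -> V -> nat) (chi : nat -> nat -> nat) :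
  (forall v, X v < n) -> (forall c v, Y c v < n) ->
  (forall i j, i < n ^ q -> j < n ^ q -> chi i j < q) ->
  exists c (x y : V -> nat), [/\
    forall v, x v < n ^ q /\ y v < n ^ q,
    forall u v, X u < X v -> x u < x v,
    forall u v, Y c u < Y c v -> y u < y v &
    forall v, chi (x v) (y v) = c].
Proof.
move=> Xn Yn; elim: q chi => [|q IH] chi chiq.
  by have := chiq 0 0; rewrite expn0 => /(_ isT isT).
set M := n ^ q in IH.
have cellP i i' : i < n -> i' < M -> i * M + i' < n ^ q.+1.
  rewrite expnS -/M => ilt i'lt.
  by rewrite (@leq_trans (i.+1 * M)) ?leq_mul2r ?ilt ?orbT // mulSn addnC ltn_add2r.
have cell_lt i i' k k' : i < k -> i' < M -> i * M + i' < k * M + k'.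
  move=> ik i'lt; rewrite (@leq_trans (i.+1 * M)) //.
    by rewrite mulSn addnC ltn_add2r.
  by rewrite (leq_trans _ (leq_addr _ _)) // leq_mul2r ik orbT.
have [[I [J [In Jn miss]]]|all] := pselect (exists I J, [/\ I < n, J < n &
    forall i j, i < M -> j < M -> chi (I * M + i) (J * M + j) != q]).
  have [|c [x [y [xyM hx hy hc]]]] := IH (fun i j => chi (I * M + i) (J * M + j)).
    by move=> i j iM jM; rewrite ltn_neqAle miss // -ltnS chiq ?cellP.
  exists c, (fun v => I * M + x v), (fun v => J * M + y v); split=> //.
  - by move=> v; have [? ?] := xyM v; rewrite !cellP.
  - by move=> u v /hx; rewrite ltn_add2l.
  - by move=> u v /hy; rewrite ltn_add2l.
have /choice[f fE] : forall v, exists ij : nat * nat,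
    [/\ ij.1 < M, ij.2 < M & chi (X v * M + ij.1) (Y q v * M + ij.2) = q].
  move=> v; apply: contrapT => none; apply: all; exists (X v), (Y q v); split=> //.
  move=> i j iM jM; apply/eqP => h; apply: none; exists (i, j); split=> //.
exists q, (fun v => X v * M + (f v).1), (fun v => Y q v * M + (f v).2); split.
- by move=> v; have [? ? _] := fE v; rewrite !cellP.
- by move=> u v uv; apply: cell_lt => //; case: (fE u).
- by move=> u v uv; apply: cell_lt => //; case: (fE u).
- by move=> v; case: (fE v).
Qed.

Section GridPermutationGraph.
Variables (G : sgraph) (q : nat) (l r : G -> nat) (kappa : G -> 'I_q.+1).
Variable e : 'I_q.+1 -> 'I_q.+1 -> bool.
Hypothesis l_lt_r : forall v, l v < r v.
Hypothesis adjE : forall u v, u != v ->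
  adj u v = crossing (l u) (r u) (l v) (r v) (+) e (kappa u) (kappa v).

(** When all left ends precede all right ends, chords cross iff their left and right ends come in
    the same order. A pattern inside one colour thus gives a permutation graph, up to
    complementation by [e]. *)
Lemma grid_permutation_graph (d : Order.disp_t) (V : finOrderType d) (s : {perm V}) :
  has_grid (#|V| ^ q.+1).+1 (fun i j => exists v, l v = i /\ r v = j) ->
  exists2 phi : V -> G, injective phi &
    forall u v, adj (phi u) (phi v) = permutation_adj s u v.
Proof.
set n := #|V|; set T := n ^ q.+1 => -[a [b [ha hb grid]]].
have [w0 _] : exists w0 : G, True.
  by have [_ [_ [[v _] _ _]]] := grid 0 0 isT isT; exists v.
have /choice[w wE] : forall ij : nat * nat, exists v,
    ij.1 < T.+1 -> ij.2 < T.+1 -> a (l v) = ij.1 /\ b (r v) = ij.2.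
  move=> [i j]; have [/andP[iT jT]|h] := boolP ((i < T.+1) && (j < T.+1)).
    by have [x [y [[v [<- <-]] ? ?]]] := grid i j iT jT; exists v.
  by exists w0 => /= iT jT; rewrite iT jT in h.
(* Column 0 and row [T] are reserved: the chord [w (T, 0)] starts after every left end and stops
   before every right end of the chords [z i j]. *)
pose z i j := w (i, j.+1).
have zE i j : i < T -> j < T -> a (l (z i j)) = i /\ b (r (z i j)) = j.+1.
  by move=> iT jT; apply: wE => //=; apply: ltnW.
have mono (f : nat -> nat) x y : {homo f : x y / x <= y} -> f x < f y -> x < y.
  by move=> hf; rewrite !ltnNge; apply: contra => /hf.
have lz_lt_rz i j i' j' : i < T -> j < T -> i' < T -> j' < T -> l (z i j) < r (z i' j').
  move=> iT jT iT' jT'.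
  have [al br] := wE (T, 0) (ltnSn _) isT; have [al1 _] := zE i j iT jT.
  have [_ br1] := zE i' j' iT' jT'.
  apply: (@ltn_trans (l (w (T, 0)))); first by apply: (mono a) => //; rewrite al al1.
  apply: ltn_trans (l_lt_r _) _; apply: (mono b) => //; by rewrite br br1.
pose rk : V -> nat := rank (fun x : V => x).
(* In an uncomplemented colour adjacency means increasing right ends, so inversions of [s] require
   the reversed pattern. *)
pose Y c v := if e (inord c) (inord c) then rk (s v) else n.-1 - rk (s v).
have rkn v : rk v < n by apply: rank_bound.
have [|||c [x [y [xyT hx hy hc]]]] :=
  @monochromatic_pattern V n q.+1 rk Y (fun i j => kappa (z i j)).
- exact: rkn.
- by move=> c v; rewrite /Y; have := rkn (s v); case: ifP => _; lia.
- by move=> i j _ _; apply: ltn_ord.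
pose phi v := z (x v) (y v).
have xT v : x v < T by case: (xyT v).
have yT v : y v < T by case: (xyT v).
have l_phi u v : (u < v)%O -> l (phi u) < l (phi v).
  rewrite -(rank_lt (fun x : V => x)) => /hx xuv; apply: (mono a) => //.
  by rewrite (zE _ _ (xT u) (yT u)).1 (zE _ _ (xT v) (yT v)).1.
have r_phi u v : Y c u < Y c v -> r (phi u) < r (phi v).
  move=> /hy yuv; apply: (mono b) => //.
  by rewrite (zE _ _ (xT u) (yT u)).2 (zE _ _ (xT v) (yT v)).2.
have phi_neq u v : (u < v)%O -> phi u != phi v.
  by move=> /l_phi; apply: contraTneq => ->; rewrite ltnn.
have kphi v : kappa (phi v) = inord c.
  by apply/val_inj; rewrite /= -(hc v) inord_val.
have crossE u v : (u < v)%O ->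
    crossing (l (phi u)) (r (phi u)) (l (phi v)) (r (phi v)) = (r (phi u) < r (phi v)).
  move=> uv; rewrite /crossing l_phi // lz_lt_rz //=.
  by rewrite [l (phi v) < l _]ltnNge (ltnW (l_phi _ _ uv)) orbF.
have adj_lt u v : (u < v)%O -> adj (phi u) (phi v) = (s v < s u)%O.
  move=> uv; rewrite adjE ?phi_neq // crossE // !kphi.
  have suv : s u != s v by rewrite (inj_eq perm_inj) lt_eqF.
  have := r_phi u v; have := r_phi v u; rewrite /Y.
  have ru := rkn (s u); have rv := rkn (s v).
  case: ifP => _ h1 h2; case: (ltgtP (s u) (s v)) suv => // lt _.
  - by rewrite h2 ?rank_lt.
  - by rewrite ltnNge ltnW ?h1 ?rank_lt.
  - rewrite -(rank_lt (fun x : V => x)) in lt.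
    by rewrite ltnNge ltnW // h1 //; move: lt ru rv; rewrite -/(rk _) -/(rk _); lia.
  - rewrite -(rank_lt (fun x : V => x)) in lt.
    by rewrite h2 //; move: lt ru rv; rewrite -/(rk _) -/(rk _); lia.
exists phi.
  move=> u v uv; apply/eqP; case: (ltgtP u v) => // /phi_neq; by rewrite uv eqxx.
move=> u v; rewrite /permutation_adj.
case: (ltgtP u v) => [uv|vu|->] /=.
- by rewrite adj_lt // orbF.
- by rewrite adj_sym adj_lt.
- by rewrite adj_irrefl.
Qed.
End GridPermutationGraph.

Lemma hereditary_embed (C : graph_class) (G P : sgraph) (phi : P -> G) :
  hereditary C -> C G -> injective phi ->
  (forall u v, adj (phi u) (phi v) = adj u v) -> C P.
Proof.
move=> [isoC indC] CG inj_phi adj_phi.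
pose S := [set phi u | u : P].
apply: isoC (indC G S CG).
have phiS u : phi u \in S by apply: imset_f.
pose g u : induced S := exist _ (phi u) (phiS u).
have [||g' gK g'K] := @inj_card_bij P (induced S) g.
- by move=> u v [/inj_phi].
- by rewrite card_sig -(card_imset _ inj_phi).
exists g'; first by exists g.
by move=> u v; rewrite -{2}(g'K u) -{2}(g'K v) -adj_phi.
Qed.

(** The colour records in binary to which sets a vertex belongs, and [e] is the parity of the number
    of common sets. The bijection [h] identifies the two vertex types, which agree only by
    computation. *)
Lemma perturbs_coloured (r : nat) (G : sgraph) (Xs : seq {set G}) : size Xs <= r ->
  exists (h : perturbs Xs -> G) (kappa : G -> nat) (e : nat -> nat -> bool),
    [/\ bijective h, forall v, kappa v < 2 ^ r &
        forall u v, u != v ->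
          adj u v = adj (h u) (h v) (+) e (kappa (h u)) (kappa (h v))].
Proof.
elim: r G Xs => [|r IH] G [|X Ys] //= Xsr.
- exists id, (fun=> 0), (fun _ _ => false); split=> // [|u v _]; first by exists id.
  by rewrite addbF.
- exists id, (fun=> 0), (fun _ _ => false); split=> // [|v|u v _]; first by exists id.
    by rewrite expn_gt0.
  by rewrite addbF.
have [h [kappa [e [bijh kr adjE]]]] := IH (perturb X) Ys Xsr.
(* The lowest bit is membership in [X], the higher ones encode [Ys]. *)
exists h, (fun v => (v \in X) + (kappa v).*2),
  (fun a b => e a./2 b./2 (+) (odd a && odd b)); split=> // [v|u v uv].
  by rewrite expnS; have := kr v; case: (v \in X) => /=; lia.
rewrite adjE //= /perturb_adj (inj_eq (bij_inj bijh)) uv /=.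
by rewrite !half_bit_double !oddD !odd_double !addbF !oddb -!addbA [X in _ (+) X]addbC.
Qed.

(** * Permutation graphs of large twin-width *)

Definition separators (G : sgraph) (u v : G) : {set G} :=
  [set w | [&& w != u, w != v & adj u w (+) adj v w]].

Lemma separators_sym (G : sgraph) (u v : G) : separators u v = separators v u.
Proof. by apply/setP => w; rewrite !inE andbCA addbC. Qed.

Lemma separators_red_degree (G : sgraph) (u v : G) :
  #|separators u v| <= max_red_degree (@contract (trigraph_of G) u v).
Proof.
apply: (@leq_trans (red_degree (None : @contract (trigraph_of G) u v))); last first.
  exact: leq_bigmax.
pose f (w : G) : @contract (trigraph_of G) u v := insub w.
have fE w : w \in separators u v -> exists2 z, f w = Some z & val z = w.
  rewrite inE => /and3P[wu wv _]; rewrite /f; case: insubP => [z _ zw|]; first by exists z.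
  by rewrite !inE negb_or wu wv.
rewrite -(card_in_imset (f := f)) => [|w w' /fE[z -> zw] /fE[z' -> zw'] [zz']]; last first.
  by rewrite -zw -zw' zz'.
apply: subset_leq_card; apply/fintype.subsetP => _ /imsetP[w wS ->].
have [z -> zw] := fE w wS; rewrite inE /= zw.
by move: wS; rewrite inE => /and3P[].
Qed.

Lemma separators_twin_width (G : sgraph) c : 1 < #|G| ->
  (forall u v : G, u != v -> c < #|separators u v|) -> c < twin_width G.
Proof.
move=> G1 sep; rewrite ltnNge; apply/negP => /twin_width_leP[s].
case: s => [le1|u v uv s]; first by move: G1; rewrite ltnNge le1.
rewrite /= geq_max => /andP[_]; apply/negP; rewrite -ltnNge.
apply: leq_trans (sep u v uv) _; apply: leq_trans (separators_red_degree u v) _.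
by case: s => [//|x y xy s] /=; apply: leq_maxl.
Qed.

Section GridPermutation.
Variable k : nat.

Let V : finOrderType _ := ('I_k *l 'I_k)%type.

Definition grid_map (x : V) : V := (rev_ord x.2, x.1).

Lemma grid_map_inj : injective grid_map.
Proof.
move=> [a b] [a' b'] [] e ->; congr (_, _); apply/val_inj => /=.
by have := ltn_ord b; have := ltn_ord b'; lia.
Qed.

Definition grid_graph : sgraph := permutation_graph (perm grid_map_inj).

(** With equal second coordinates both orders compare the first coordinates, so there is no
    inversion; with equal first coordinates there always is one. *)
Lemma grid_adj (x y : grid_graph) : adj x y =
  (x.1 <= y.1) && (x.2 < y.2) || (y.1 <= x.1) && (y.2 < x.2).
Proof.
case: x y => [a b] [a' b'].
have ltE (x y : V) : (x < y)%O = (x.1 <= y.1) && ((y.1 <= x.1) ==> (x.2 < y.2)) by [].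
rewrite /= /permutation_adj !permE !ltE /=.
have := ltn_ord b; have := ltn_ord b'; lia.
Qed.

Lemma separators_grid (u v : grid_graph) : u != v -> k - 2 <= #|separators u v|.
Proof.
suff main (x y : grid_graph) : (x.1 < y.1) || (x.1 == y.1 :> nat) && (x.2 < y.2) ->
    k - 2 <= #|separators x y|.
  move: u v => [a b] [a' b'] uv.
  have [h|h] := boolP ((a < a') || (a == a' :> nat) && (b < b')); first exact: main.
  rewrite separators_sym; apply: main => /=.
  have : (a != a' :> nat) || (b != b' :> nat).
    by move: uv; rewrite xpair_eqE negb_and -!(inj_eq val_inj).
  by move: h; case: ltngtP => //=; case: ltngtP.
move: x y => [a b] [a' b'] /= ab.
have count (f : 'I_k -> grid_graph) (i j : 'I_k) : injective f ->
    (forall z, z != i -> z != j -> f z \in separators ((a, b) : grid_graph) (a', b')) ->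
    k - 2 <= #|separators ((a, b) : grid_graph) (a', b')|.
  move=> injf fS; apply: (@leq_trans #|f @: ~: [set i; j]|).
    rewrite card_imset // cardsCs setCK card_ord leq_sub2l // cards2.
    by case: (i != j).
  apply: subset_leq_card; apply/fintype.subsetP => _ /imsetP[z + ->].
  by rewrite in_setC in_set2 negb_or => /andP[]; apply: fS.
have [bb|bb] := leqP b' b.
(* Here [a < a']. For [j] above [b'], the vertex [(a, j)] sees only [(a, b)]; for [j] below,
   [(a', j)] sees only [(a', b')]. *)
- apply: (count (fun j => if b' <= j then (a, j) else (a', j)) b b').
    by move=> j j'; case: ifP; case: ifP => _ _ [].
  move=> j jb jb'; rewrite inE !grid_adj.
  by move: jb jb' ab; case: ifP; rewrite /= !xpair_eqE -!(inj_eq val_inj) /=; lia.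
(* Equal second coordinates exclude edges: [(i, b)] with [i < a'] sees only [(a', b')], and
   [(i, b')] with [i > a'] sees only [(a, b)]. *)
- apply: (count (fun i => if i <= a' then (i, b) else (i, b')) a a').
    by move=> j j'; case: ifP; case: ifP => _ _ [].
  move=> j jb jb'; rewrite inE !grid_adj.
  by move: jb jb' ab; case: ifP; rewrite /= !xpair_eqE -!(inj_eq val_inj) /=; lia.
Qed.
End GridPermutation.

Lemma permutation_graphs_unbounded (C : graph_class) :
  contains_all_permutation_graphs C -> ~ bounded_twin_width C.
Proof.
(* Side [c.+3] gives [c.+1] separators, one more than the assumed bound. *)
move=> all [c cP]; have := cP _ (all _ _ (perm (@grid_map_inj c.+3))).
apply/negP; rewrite -ltnNge; apply: separators_twin_width.
  by rewrite /= card_prod card_ord; lia.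
by move=> u v /separators_grid; rewrite subSS subSS subn0.
Qed.

Theorem theorem4p2 (R : realType) (r : nat) (C : graph_class)
    (hereditaryC : hereditary C)
    (perturbationC : forall G : sgraph, C G ->
       exists2 H : sgraph, circle_graph R H & bounded_perturbation r H G) :
  bounded_twin_width C <-> ~ contains_all_permutation_graphs C.
Proof.
split=> [bC /permutation_graphs_unbounded //|].
move=> /existsNP[d /existsNP[V /existsNP[s nCs]]].
(* There are [q.+1 = 2 ^ r] colours, and [t] is the grid size that forces the permutation graph of
   [s]. *)
pose q := (2 ^ r).-1; pose t := (#|V| ^ q.+1).+1.
have qE : q.+1 = 2 ^ r by rewrite prednK // expn_gt0.
exists (twin_width_constant q t) => G CG.
have [H /circle_diagram[l [r' [injl injr l_lt_r lr adjH]]] [Xs Xsr [f [g fK gK] adjf]]] :=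
  perturbationC G CG.
have [h [kappa [e [bijh kr adjX]]]] := perturbs_coloured Xsr.
(* [p] sends a vertex of [G] to the vertex of [H] whose chord represents it. *)
pose p v := h (g v).
have injp : injective p by apply: inj_comp (bij_inj bijh) (can_inj gK).
pose kp v : 'I_q.+1 := inord (kappa (p v)).
have kpE v : kp v = kappa (p v) :> nat by rewrite inordK // qE.
have adjG u v : u != v -> adj u v =
    crossing (l (p u)) (r' (p u)) (l (p v)) (r' (p v)) (+) e (kp u) (kp v).
  move=> uv; rewrite !kpE -adjH ?(inj_eq injp) // -[u in LHS]gK -[v in LHS]gK adjf.
  by rewrite adjX // (can_eq gK).
apply: (@diagram_twin_width G q t (l \o p) (r' \o p) kp (fun a b => e a b)) => //.
- exact: inj_comp.
- exact: inj_comp.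
- by move=> u v; apply: lr.
- move=> grid; apply: nCs.
  have [phi inj_phi adj_phi] :=
    @grid_permutation_graph G q (l \o p) (r' \o p) kp (fun a b => e a b)
      (fun v => l_lt_r (p v)) adjG d V s grid.
  exact: (@hereditary_embed C G (permutation_graph s) phi).
Qed.
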